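(* Let $F$ be a non-Archimedean local field of characteristic zero and let $K/F$ be a quadratic wildly ramified extension, with ramification break $t$. Let $\omega_{K/F}$ be the quadratic character of $F^\times$ attached to $K/F$ by local class field theory. Then: (i) the conductor of $\omega_{K/F}$ is $a(\omega_{K/F})=t+1$; (ii) if $\chi$ is a symplectic type character of $K^\times$ with conductor $m=a(\chi)$, then $m=2t+1$ when $m$ is odd, and $m\ge 2(t+1)$ when $m$ is even.
   Context: For a non-Archimedean local field $E$: $O_E$ is its ring of integers, $P_E$ the maximal ideal, $\nu_E$ the normalized valuation, $U_E=O_E^\times$, $U_E^0=U_E$ and $U_E^i=1+P_E^i$ for $i\ge1$. The conductor $a(\chi)$ of a character $\chi:E^\times\to\mathbb{C}^\times$ is the smallest integer $i\ge 0$ such that $\chi$ is trivial on $U_E^i$. The extension $K/F$ is wildly ramified if the residue characteristic divides $[K:F]=2$ (so the residue characteristic is $2$). For $G=\mathrm{Gal}(K/F)$ the lower ramification groups are $G_i=\{\sigma\in G:\nu_K(\sigma(\alpha)-\alpha)\ge i+1 \ \forall \alpha\in O_K\}$; for quadratic $K/F$ the ramification break is the unique integer $t$ with $G_t=G$ and $G_{t+1}=\{1\}$ (in the wild case $t\ge1$). $\omega_{K/F}$ is the unique nontrivial character of $F^\times$ trivial on $N_{K/F}(K^\times)$. A character $\chi$ of $K^\times$ is of symplectic type if $\chi|_{F^\times}=\omega_{K/F}$. *)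

(* Defs.v *)
From HB Require Import structures.
From mathcomp Require Import all_boot all_order all_algebra all_field.
Set Implicit Arguments. Unset Strict Implicit. Unset Printing Implicit Defensive.
Import Order.TTheory GRing.Theory Num.Theory.
Local Open Scope ring_scope.

(* "v x >= n", with the convention v 0 = +infinity (the value v 0 is ignored). *)
Definition vge (R : fieldType) (v : R -> int) (x : R) (n : int) : Prop :=
  x = 0 \/ n <= v x.

Definition discrete_valuation (R : fieldType) (v : R -> int) : Prop :=
  [/\ forall x y : R, x != 0 -> y != 0 -> v (x * y) = v x + v y,
      forall x y : R, x != 0 -> y != 0 -> x + y != 0 ->
        Num.min (v x) (v y) <= v (x + y)
    & exists pi : R, pi != 0 /\ v pi = 1].

Definition v_complete (R : fieldType) (v : R -> int) : Prop :=
  forall u : nat -> R,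
    (forall n : int, exists N : nat, forall i j : nat,
        (N <= i)%N -> (N <= j)%N -> vge v (u i - u j) n) ->
    exists l : R, forall n : int, exists N : nat, forall i : nat,
        (N <= i)%N -> vge v (u i - l) n.

Definition finite_residue_field (R : fieldType) (v : R -> int) : Prop :=
  exists s : seq R, forall x : R, vge v x 0 ->
    exists2 y : R, y \in s & vge v (x - y) 1.

Definition nonarch_local_field (R : fieldType) (v : R -> int) : Prop :=
  [/\ discrete_valuation v, v_complete v & finite_residue_field v].

Definition in_U (R : fieldType) (v : R -> int) (i : nat) (x : R) : Prop :=
  if i is 0%N then x != 0 /\ v x = 0 else vge v (x - 1) i%:Z.

(* A character of R^x with values in C^x, encoded as a function on R whose
   value at 0 is irrelevant. *)
Definition is_character (R : fieldType) (C : fieldType) (chi : R -> C) : Prop :=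
  (forall x y : R, x != 0 -> y != 0 -> chi (x * y) = chi x * chi y) /\
  (forall x : R, x != 0 -> chi x != 0).

Definition trivial_on_U (R : fieldType) (C : fieldType) (v : R -> int)
    (chi : R -> C) (i : nat) : Prop :=
  forall x : R, in_U v i x -> chi x = 1.

Definition is_conductor (R : fieldType) (C : fieldType) (v : R -> int)
    (chi : R -> C) (m : nat) : Prop :=
  trivial_on_U v chi m /\ forall i : nat, trivial_on_U v chi i -> (m <= i)%N.

(* Ramification break of G = {1, sigma}: G_t = G and G_{t+1} = {1}, where
   G_i = {g : nu_K(g a - a) >= i+1 for all a in O_K}. *)
Definition ramification_break (K : fieldType) (vK : K -> int) (sigma : K -> K)
    (t : nat) : Prop :=
  (forall a : K, vge vK a 0 -> vge vK (sigma a - a) (t.+1)%:Z) /\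
  ~ (forall a : K, vge vK a 0 -> vge vK (sigma a - a) (t.+2)%:Z).

(* Main.v *)
(** Fix a uniformizer [Pi] of [K] and put [delta = sigma Pi - Pi], of valuation
    [t + 1]. As [(1, Pi)] is an [F]-basis of [K] with valuations of different
    parity, [vK (sigma y - y) >= vK y + t], [vK 2 >= t] and hence
    [vK (Tr y) >= vK y + t].

    The element [- Pi / delta] has trace 1 and valuation [- t], so its norm form
    together with Hensel's lemma shows [U_F^(t+1)] to consist of norms. For
    [0 < i < t] the trace bound makes [N (1 + w Pi^i)] congruent to
    [1 + w^2 N(Pi)^i] modulo [P_F^(i+1)], and every residue is a square; so
    [F^x = N(K^x) U_F^t] and [omega] cannot be trivial on [U_F^t].

    Since [U_F^t] lies in [U_K^(2t)], a symplectic [chi] has conductor [m > 2t].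
    If [m = 2k + 1] with [k > t], then [U_K^(2k) = U_F^k U_K^(2k+1)] and the
    triviality of [omega] on [U_F^k] contradict the minimality of [m]. *)
Require Import Defs.
From HB Require Import structures.
From mathcomp Require Import all_boot all_order all_algebra all_field.
From mathcomp Require Import zify ring.
Import Order.TTheory GRing.Theory Num.Theory.
Local Open Scope ring_scope.

(** * Arithmetic of one discrete valuation *)

Section Valuation.

Variables (R : fieldType) (v : R -> int).
Hypothesis dv : discrete_valuation v.

Lemma valM x y : x != 0 -> y != 0 -> v (x * y) = v x + v y.
Proof. by case: dv => vM _ _; exact: vM. Qed.

Lemma val1 : v 1 = 0.
Proof. have := valM 1 1 (oner_neq0 _) (oner_neq0 _); rewrite mulr1; lia. Qed.

Lemma valN x : v (- x) = v x.
Proof.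
have [->|x0] := eqVneq x 0; first by rewrite oppr0.
have N10 : -1 != 0 :> R by rewrite oppr_eq0 oner_neq0.
have := valM (-1) (-1) N10 N10; rewrite mulrNN mulr1 val1 => vN1.
by rewrite -mulN1r valM //; lia.
Qed.

Lemma valV x : x != 0 -> v x^-1 = - v x.
Proof.
move=> x0; have xV0 : x^-1 != 0 by rewrite invr_eq0.
by have := valM _ _ x0 xV0; rewrite divff // val1; lia.
Qed.

Lemma valX x n : x != 0 -> v (x ^+ n) = v x *+ n.
Proof.
move=> x0; elim: n => [|n IH]; first by rewrite expr0 val1.
by rewrite exprS valM ?expf_neq0 // IH mulrS.
Qed.

Lemma vge_val x n : x != 0 -> vge v x n -> n <= v x.
Proof. by move=> x0 [x_eq0|//]; rewrite x_eq0 eqxx in x0. Qed.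

Lemma vgeW x m n : n <= m -> vge v x m -> vge v x n.
Proof. by move=> nm [->|mx]; [left | right; exact: le_trans mx]. Qed.

Lemma vge1 : vge v 1 0.
Proof. by right; rewrite val1. Qed.

Lemma vgeD x y n : vge v x n -> vge v y n -> vge v (x + y) n.
Proof.
have [->|x0] := eqVneq x 0; first by rewrite add0r.
have [->|y0] := eqVneq y 0; first by rewrite addr0.
have [->|xy0] := eqVneq (x + y) 0; first by left.
move=> /(vge_val _ _ x0) nx /(vge_val _ _ y0) ny; right.
by case: dv => _ vD _; apply: le_trans (vD _ _ x0 y0 xy0); rewrite le_min nx.
Qed.

Lemma vgeN x n : vge v x n -> vge v (- x) n.
Proof. by move=> [->|nx]; [left; rewrite oppr0 | right; rewrite valN]. Qed.

Lemma vgeB x y n : vge v x n -> vge v y n -> vge v (x - y) n.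
Proof. by move=> nx /vgeN; exact: vgeD. Qed.

Lemma vgeM x y m n : vge v x m -> vge v y n -> vge v (x * y) (m + n).
Proof.
have [->|x0] := eqVneq x 0; first by rewrite mul0r; left.
have [->|y0] := eqVneq y 0; first by rewrite mulr0; left.
by move=> /(vge_val _ _ x0) mx /(vge_val _ _ y0) ny; right; rewrite valM // lerD.
Qed.

Lemma vgeMr x y n : vge v x n -> vge v y 0 -> vge v (x * y) n.
Proof. by move=> xn y0; rewrite -[n]addr0; exact: vgeM. Qed.

Lemma vgeX x n : vge v x 0 -> vge v (x ^+ n) 0.
Proof.
by move=> x0; elim: n => [|n IH]; [exact: vge1 | rewrite exprS; exact: vgeMr].
Qed.

Lemma vge_sqr x : vge v (x ^+ 2) 1 -> vge v x 1.
Proof.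
have [->|x0] := eqVneq x 0; first by left.
move=> /(vge_val _ _ (expf_neq0 _ x0)); rewrite valX // => h; right; lia.
Qed.

(** If [x + y] had larger value than [x], then so would [x = (x + y) - y]. *)
Lemma val_addl x y : x != 0 -> vge v y (v x + 1) -> x + y != 0 /\ v (x + y) = v x.
Proof.
move=> x0 vy; have xy0 : x + y != 0.
  apply/eqP => /eqP; rewrite addr_eq0 => /eqP xy.
  by move: vy; rewrite -[y]opprK -xy => /vgeN; rewrite opprK => /(vge_val _ _ x0); lia.
split=> //; apply/eqP; rewrite eq_le; apply/andP; split; last first.
  by apply: (vge_val _ _ xy0); apply: vgeD; [right | apply: vgeW vy; lia].
rewrite leNgt; apply/negP => lt.
have /(vge_val _ _ x0) : vge v x (v x + 1); last by lia.
have xE : x = (x + y) - y by rewrite addrK.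
by rewrite [X in vge _ X]xE; apply: vgeB vy; right; rewrite lezD1.
Qed.

Lemma val_add1 c : vge v c 1 -> 1 + c != 0 /\ v (1 + c) = 0.
Proof.
by move=> c1; rewrite -val1; apply: val_addl; rewrite ?oner_neq0 // val1.
Qed.

Lemma in_U_le (i j : nat) x : (j <= i)%N -> in_U v i x -> in_U v j x.
Proof.
case: i => [|i]; first by case: j.
case: j => [|j] //= ji Ux; last by apply: vgeW Ux; lia.
have [] := val_add1 (x - 1) (vgeW _ _ _ _ Ux); first lia.
by rewrite addrC subrK.
Qed.

Lemma vge_all0 x : (forall n : nat, vge v x n) -> x = 0.
Proof.
move=> h; have [//|x0] := eqVneq x 0.
have /(vge_val _ _ x0) := h `|v x|.+1; lia.
Qed.

(* A contraction: if [u] and [u'] are integral and agree modulo [P^n], then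
   [1 - e u^2] and [1 - e u'^2] agree modulo [P^(n+1)]. *)
Lemma quadratic_fixpoint e : v_complete v -> vge v e 1 ->
  exists2 w, vge v w 0 & w + e * w ^+ 2 = 1.
Proof.
move=> cv ve; pose u n := iter n (fun w => 1 - e * w ^+ 2) 0.
have uS n : u n.+1 = 1 - e * u n ^+ 2 by [].
have step x y n : vge v x 0 -> vge v y 0 -> vge v (x - y) n ->
    vge v (e * x ^+ 2 - e * y ^+ 2) (n + 1).
  move=> x0 y0 xy; have -> : e * x ^+ 2 - e * y ^+ 2 = e * ((x - y) * (x + y)) by ring.
  by rewrite (addrC n); apply: vgeM => //; apply: vgeMr => //; exact: vgeD.
have u0 n : vge v (u n) 0.
  elim: n => [|n IH]; first by left.
  rewrite uS; apply: vgeB vge1 _; apply: (vgeW _ 1) => //.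
  by apply: vgeMr => //; exact: vgeX.
have du n : vge v (u n.+1 - u n) n.
  elim: n => [|n IH]; first exact: (vgeB _ _ _ (u0 1%N) (u0 0%N)).
  have -> : u n.+2 - u n.+1 = - (e * u n.+1 ^+ 2 - e * u n ^+ 2) by rewrite !uS; ring.
  by apply: vgeN; rewrite intS (addrC 1); exact: step.
have duk n k : vge v (u (n + k)%N - u n) n.
  elim: k => [|k IH]; first by rewrite addn0 subrr; left.
  have -> : u (n + k.+1)%N - u n = (u (n + k).+1 - u (n + k)%N) + (u (n + k)%N - u n).
    by rewrite addnS; ring.
  by apply: vgeD => //; apply: vgeW (du _); lia.
have [|l lP] := cv u.
  move=> n; exists `|n|%N => i j ni nj.
  apply: (vgeW _ `|n|%N); first lia.
  have -> : u i - u j = (u i - u `|n|%N) - (u j - u `|n|%N) by ring.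
  by apply: vgeB; [rewrite -(subnKC ni) | rewrite -(subnKC nj)]; exact: duk.
have l0 : vge v l 0.
  have [N /(_ N (leqnn _)) ul] := lP 0.
  have -> : l = u N - (u N - l) by ring.
  exact: vgeB.
exists l => //; apply/eqP; rewrite -subr_eq0; apply/eqP; apply: vge_all0 => n.
have [N h] := lP n.
(* The recurrence for [u N.+1] absorbs the constant 1, leaving two differences that are small for
   large [N]. *)
have -> : l + e * l ^+ 2 - 1 = - (e * u N ^+ 2 - e * l ^+ 2) - (u N.+1 - l).
  by rewrite uS; ring.
apply: vgeB (h _ _); last exact: leqnSn.
by apply: vgeN; apply: (vgeW _ (n%:Z + 1)); [lia | apply: step => //; exact: h].
Qed.

(* Frobenius is injective on the finite residue field, so two of the residues
   of [x ^ (2 ^ n)] coincide and [x] itself is among the later ones. *)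
Lemma residue_sqr x : finite_residue_field v -> vge v 2 1 -> vge v x 0 ->
  exists2 w, vge v w 0 & vge v (x - w ^+ 2) 1.
Proof.
move=> [s sP] v2 x0; pose y n := x ^+ (2 ^ n).
have y0 n : vge v (y n) 0 by exact: vgeX.
have yS n : y n.+1 = y n ^+ 2 by rewrite /y expnSr exprM.
have frob a b : vge v a 0 -> vge v b 0 -> vge v (a ^+ 2 - b ^+ 2) 1 -> vge v (a - b) 1.
  move=> a0 b0 ab; apply: vge_sqr.
  have -> : (a - b) ^+ 2 = (a ^+ 2 - b ^+ 2) - 2 * (b * (a - b)) by ring.
  by apply: vgeB => //; apply: vgeMr => //; apply: vgeMr => //; exact: vgeB.
have /fin_all_exists [r rP] : forall n : 'I_(size s).+1, exists k : 'I_(size s),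
    vge v (y n - nth 0 s k) 1.
  move=> n; have [z zs hz] := sP _ (y0 n).
  have zi : (index z s < size s)%N by rewrite index_mem.
  by exists (Ordinal zi); rewrite /= nth_index.
have : ~~ injectiveb r.
  by apply/injectiveP => /leq_card; rewrite !card_ord ltnn.
case/injectivePn => i [j ij rij].
have col : vge v (y i - y j) 1.
  have -> : y i - y j = (y i - nth 0 s (r i)) - (y j - nth 0 s (r i)) by ring.
  by apply: vgeB; [exact: rP | rewrite rij; exact: rP].
have pull n k : vge v (y (n + k)%N - y n) 1 -> vge v (y k - y 0%N) 1.
  elim: n => [//|n IH]; rewrite addSn !yS => h; apply: IH; exact: frob.
(* As [i != j], the period is positive and can be written [k.+1], so [x] is congruent to the square
   of [y k]. *)
have [k hk] : exists k, vge v (y k.+1 - y 0%N) 1.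
  have [lt|lt|/ord_inj/eqP] := ltngtP i j; last by rewrite (negbTE ij).
  - exists (j - i).-1; apply: (pull i); rewrite prednK ?subn_gt0 // subnKC 1?ltnW //.
    by rewrite -opprB; exact: vgeN.
  - by exists (i - j).-1; apply: (pull j); rewrite prednK ?subn_gt0 // subnKC 1?ltnW.
exists (y k) => //; rewrite -opprB; apply: vgeN.
by move: hk; rewrite yS {2}/y expn0 expr1.
Qed.

End Valuation.

(** * Characters of the multiplicative group of a field *)

Section Characters.

Variables (R C : fieldType) (chi : R -> C).
Hypothesis hchi : is_character chi.

Lemma charM x y : x != 0 -> y != 0 -> chi (x * y) = chi x * chi y.
Proof. by case: hchi => h _; exact: h. Qed.

Lemma char1 : chi 1 = 1.
Proof.
have chi10 : chi 1 != 0 by case: hchi => _; apply; exact: oner_neq0.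
apply: (mulfI chi10); rewrite mulr1 -charM ?oner_neq0 //; by rewrite mulr1.
Qed.

Lemma charX1 x n : x != 0 -> chi x = 1 -> chi (x ^+ n) = 1.
Proof.
move=> x0 chix; elim: n => [|n IH]; first by rewrite expr0 char1.
by rewrite exprS charM ?expf_neq0 // chix IH mulr1.
Qed.

Lemma trivial_on_U_le (v : R -> int) (i j : nat) : discrete_valuation v ->
  (i <= j)%N -> trivial_on_U v chi i -> trivial_on_U v chi j.
Proof. by move=> dv ij h x Ux; apply: h; exact: in_U_le Ux. Qed.

End Characters.

(** * Traces, norms and conjugation in a ramified quadratic extension *)

Section RamifiedQuadratic.

Variables (F : fieldType) (K : fieldExtType F) (vF : F -> int) (vK : K -> int).
Variables (sigma : {rmorphism K -> K}) (t : nat) (Pi : K).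
Hypothesis dimK : \dim {:K} = 2%N.
Hypothesis dvF : discrete_valuation vF.
Hypothesis dvK : discrete_valuation vK.
Hypothesis vKA : forall a : F, a != 0 -> vK (a%:A) = vF a *+ 2.
Hypothesis vF2 : vge vF 2 1.
Hypothesis sigmaA : forall a : F, sigma (a%:A) = a%:A.
Hypothesis sigma_neq : exists x : K, sigma x != x.
Hypothesis tP : ramification_break vK sigma t.
Hypothesis Pi0 : Pi != 0.
Hypothesis vPi : vK Pi = 1.

Local Notation iota := (in_alg K).

Lemma vK_iota a : a != 0 -> vK (iota a) = vF a *+ 2.
Proof. exact: vKA. Qed.

Lemma sigma_iota a : sigma (iota a) = iota a.
Proof. exact: sigmaA. Qed.

Lemma vge_iota a n : vge vF a n -> vge vK (iota a) (n *+ 2).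
Proof.
have [->|a0] := eqVneq a 0; first by rewrite rmorph0; left.
by move=> /(vge_val _ _ _ _ a0) h; right; rewrite vK_iota //; lia.
Qed.

(* The values of [vK] on [F] are even, whence the rounding. *)
Lemma vge_iota_inv a n : vge vK (iota a) (n *+ 2 - 1) -> vge vF a n.
Proof.
have [->|a0] := eqVneq a 0; first by left.
have ia0 : iota a != 0 by rewrite fmorph_eq0.
by move=> /(vge_val _ _ _ _ ia0); rewrite vK_iota // => h; right; lia.
Qed.

Lemma vK_iotaPi b : b != 0 -> vK (iota b * Pi) = vF b *+ 2 + 1.
Proof. by move=> b0; rewrite valM ?fmorph_eq0 // vK_iota // vPi. Qed.

Lemma decomp y : exists a b, y = iota a + iota b * Pi.
Proof.
have N1 : 1 \notin <<[:: Pi]>>%VS.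
  rewrite span_seq1; apply/negP => /vlineP [k].
  have [->|k0] := eqVneq k 0; first by rewrite scale0r => /eqP; rewrite oner_eq0.
  (* Taking values in [1 = k Pi] gives [0 = 2 vF k + 1], impossible by parity. *)
  rewrite -[Pi]mul1r scalerAl => /(congr1 vK).
  by rewrite val1 // -[k *: 1]/(iota k) vK_iotaPi //; lia.
have fr : free [:: 1; Pi] by rewrite free_cons N1 seq1_free.
have : basis_of {:K}%VS [:: 1; Pi] by rewrite basisEfree fr subvf dimK.
case/andP => /eqP sp _; have : y \in <<[:: 1%R; Pi]>>%VS by rewrite sp memvf.
rewrite span_cons span_seq1 => /memv_addP [_ /vlineP [a ->]] [_ /vlineP [b ->]] ->.
by exists a, b; rewrite /= -scalerAl mul1r.
Qed.

(** Nonzero terms have values of opposite parity, so the sum has exactly the smaller of the two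
    values. *)
Lemma decomp_vge a b n : vge vK (iota a + iota b * Pi) n ->
  vge vK (iota a) n /\ vge vK (iota b * Pi) n.
Proof.
have [->|a0] := eqVneq a 0; first by rewrite rmorph0 add0r => h; split=> //; left.
have [->|b0] := eqVneq b 0; first by rewrite rmorph0 mul0r addr0 => h; split=> //; left.
have ia0 : iota a != 0 by rewrite fmorph_eq0.
have ib0 : iota b * Pi != 0 by rewrite mulf_neq0 ?fmorph_eq0.
have va := vK_iota _ a0; have vb := vK_iotaPi _ b0.
have [le|lt] := lerP (vK (iota a)) (vK (iota b * Pi)).
  have gt : vge vK (iota b * Pi) (vK (iota a) + 1) by right; lia.
  have [s0 sE] := val_addl _ _ dvK _ _ ia0 gt.
  move=> /(vge_val _ _ _ _ s0); rewrite sE => h.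
  by split; right => //; lia.
have gt : vge vK (iota a) (vK (iota b * Pi) + 1) by right; lia.
have [s0 sE] := val_addl _ _ dvK _ _ ib0 gt.
rewrite addrC => /(vge_val _ _ _ _ s0); rewrite sE => h.
by split; right => //; lia.
Qed.

Let delta := sigma Pi - Pi.

Lemma sigma_sub a b : sigma (iota a + iota b * Pi) - (iota a + iota b * Pi) = iota b * delta.
Proof. by rewrite rmorphD rmorphM !sigma_iota /delta; ring. Qed.

Lemma delta_neq0 : delta != 0.
Proof.
apply/eqP => d0; have [x /eqP] := sigma_neq; apply.
have [a [b ->]] := decomp x; apply/eqP; rewrite -subr_eq0.
by rewrite sigma_sub d0 mulr0.
Qed.

(** The break is attained at [Pi]: for integral [x = a + b Pi] one has [sigma x - x = b delta], and
    [2 vF b + 1 >= 0] forces [vF b >= 0]. *)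
Lemma val_delta : vK delta = t.+1%:Z.
Proof.
have [tP1 tP2] := tP; have d0 := delta_neq0.
have Pi_ge0 : vge vK Pi 0 by right; rewrite vPi.
have := vge_val _ _ _ _ d0 (tP1 _ Pi_ge0); rewrite le_eqVlt => /predU1P [//|lt].
case: tP2 => x; have [a [b ->]] := decomp x => /decomp_vge [_ hb].
rewrite sigma_sub; have [->|b0] := eqVneq b 0; first by rewrite rmorph0 mul0r; left.
have ib0 : iota b != 0 by rewrite fmorph_eq0.
have := vge_val _ _ _ _ (mulf_neq0 ib0 Pi0) hb; rewrite vK_iotaPi // => hb'.
by right; rewrite valM // vK_iota //; lia.
Qed.

(** Both [Pi] and [sigma Pi] are roots of [T^2 - p T - q]; subtracting the two equations and
    cancelling [delta] leaves their sum. *)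
Lemma trace_Pi : exists p, iota p = Pi + sigma Pi.
Proof.
have [q [p PiE]] := decomp (Pi ^+ 2); exists p.
have := congr1 sigma PiE; rewrite rmorphXn rmorphD rmorphM !sigma_iota => sPiE.
have : delta * (Pi + sigma Pi - iota p) = 0.
  have -> : delta * (Pi + sigma Pi - iota p) =
    (sigma Pi ^+ 2 - iota p * sigma Pi) - (Pi ^+ 2 - iota p * Pi) by rewrite /delta; ring.
  by rewrite sPiE PiE; ring.
by move/eqP; rewrite mulf_eq0 (negbTE delta_neq0) subr_eq0 => /eqP.
Qed.

Lemma sigmaK y : sigma (sigma y) = y.
Proof.
have [p pE] := trace_Pi; have sPi : sigma Pi = iota p - Pi by rewrite pE; ring.
have [a [b ->]] := decomp y.
by rewrite !(rmorphD, rmorphM, rmorphN, sPi, sigma_iota); ring.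
Qed.

Lemma sigma_fixed y : sigma y = y -> exists a, iota a = y.
Proof.
have [a [b ->]] := decomp y => /eqP; rewrite -subr_eq0 sigma_sub mulf_eq0.
by rewrite (negbTE delta_neq0) orbF => /eqP ->; exists a; rewrite mul0r addr0.
Qed.

Lemma traceP y : exists a, iota a = y + sigma y.
Proof. by apply: sigma_fixed; rewrite rmorphD sigmaK addrC. Qed.

Lemma normP y : exists a, iota a = y * sigma y.
Proof. by apply: sigma_fixed; rewrite rmorphM sigmaK mulrC. Qed.

Lemma iota2 : iota 2 = 2.
Proof. exact: rmorph_nat. Qed.

(* [delta = p - 2 Pi] with [p] the trace of [Pi]: both [vK p] and [vK 2] are even. *)
Lemma t_gt0 : (0 < t)%N.
Proof.
have [p pE] := trace_Pi.
have vd : vge vK delta 1 by right; rewrite val_delta; lia.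
have v2Pi : vge vK (2 * Pi) 2.
  rewrite -iota2; apply: (vgeW _ _ _ (1 *+ 2)) => //.
  by apply: vgeMr => //; [exact: vge_iota | right; rewrite vPi].
have vp : vge vF p 1.
  apply: vge_iota_inv; have -> : iota p = delta + 2 * Pi by rewrite pE /delta; ring.
  by apply: vgeD => //; apply: vgeW v2Pi.
have : vge vK delta 2.
  have -> : delta = iota p - 2 * Pi by rewrite pE /delta; ring.
  by apply: vgeB => //; exact: vge_iota vp.
by move=> /(vge_val _ _ _ _ delta_neq0); rewrite val_delta; lia.
Qed.

(** Applying [decomp_vge] to [delta = p - 2 Pi] bounds the value of [2 Pi] below by [t + 1]. *)
Lemma vge2 : vge vK 2 t.
Proof.
have iotaN2 : iota (-2) = -2 by rewrite rmorphN rmorph_nat.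
have [p pE] := trace_Pi; have [|_ h] := decomp_vge p (-2) t.+1%:Z.
  right; have -> : iota p + iota (-2) * Pi = delta; last by rewrite val_delta.
  by rewrite iotaN2 pE /delta; ring.
have -> : 2 = - ((iota (-2) * Pi) * Pi^-1) by rewrite mulfK // iotaN2 opprK.
apply: vgeN => //; have -> : Posz t = t.+1%:Z + (- 1) by lia.
by apply: vgeM => //; right; rewrite valV // vPi.
Qed.

(** The term [b Pi] of [y] is multiplied by [delta / Pi], of value [t]. *)
Lemma vge_sigma_sub y n : vge vK y n -> vge vK (sigma y - y) (n + t%:Z).
Proof.
have [a [b ->]] := decomp y => /decomp_vge [_ hb]; rewrite sigma_sub.
have -> : iota b * delta = (iota b * Pi) * (delta / Pi).
  by rewrite mulrACA mulfV // ?mulr1 // mulrA mulfK.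
apply: vgeM => //; right.
by rewrite valM ?invr_eq0 ?delta_neq0 // valV // vPi val_delta; lia.
Qed.

Lemma vge_trace y n : vge vK y n -> vge vK (y + sigma y) (n + t%:Z).
Proof.
move=> hy; have -> : y + sigma y = y * 2 + (sigma y - y) by ring.
by apply: vgeD => //; [apply: vgeM vge2 | exact: vge_sigma_sub].
Qed.

(** As [t > 0], [sigma y - y] has larger value than [y]. *)
Lemma val_sigma y : vK (sigma y) = vK y.
Proof.
have [->|y0] := eqVneq y 0; first by rewrite rmorph0.
have ty : vge vK (sigma y - y) (vK y + 1).
  apply: vgeW (vge_sigma_sub y (vK y) (or_intror (lexx _))).
  by have := t_gt0; lia.
by have [_] := val_addl _ _ dvK _ _ y0 ty; rewrite addrC subrK.
Qed.

Lemma norm_eq0 y a : iota a = y * sigma y -> (a == 0) = (y == 0).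
Proof. by move=> aE; rewrite -(fmorph_eq0 iota) /= [_%:A]aE mulf_eq0 fmorph_eq0 orbb. Qed.

Lemma val_norm y a : y != 0 -> iota a = y * sigma y -> vF a = vK y.
Proof.
move=> y0 aE; have sy0 : sigma y != 0 by rewrite fmorph_eq0.
have a0 : a != 0 by rewrite (norm_eq0 _ _ aE).
by have := vK_iota _ a0; rewrite aE valM // val_sigma; lia.
Qed.

(* [lam = - Pi / delta] has trace 1 and valuation [- t], so with [nu] its norm
   [N (1 + z lam) = 1 + z + nu z^2]; Hensel's lemma solves [z + nu z^2 = c]. *)
Lemma norm_U_succ c : v_complete vF -> vge vF c t.+1%:Z ->
  exists2 y, y != 0 & iota (1 + c) = y * sigma y.
Proof.
move=> cF hc; have d0 := delta_neq0; pose lam := - Pi / delta.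
have sd : sigma delta = - delta by rewrite /delta rmorphB sigmaK opprB.
have lam0 : lam != 0 by rewrite mulf_neq0 ?oppr_eq0 ?invr_eq0.
have trl : lam + sigma lam = 1.
  rewrite /lam rmorphM rmorphN fmorphV sd invrN mulrNN -mulrDl addrC.
  exact: mulfV.
have [nu nuE] := normP lam.
have vnu : vF nu = - t%:Z.
  rewrite (val_norm lam) // /lam valM ?oppr_eq0 ?invr_eq0 // valN // valV // vPi.
  by rewrite val_delta; lia.
have vcnu : vge vF (c * nu) 1.
  have -> : 1 = t.+1%:Z + (- t%:Z) by lia.
  by apply: vgeM => //; right; rewrite vnu.
(* Putting [z = c w] turns [z + nu z^2 = c] into [w + c nu w^2 = 1]. *)
have [w _ wE] := quadratic_fixpoint _ _ dvF _ cF vcnu.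
have E : iota (1 + c) = (1 + iota (c * w) * lam) * sigma (1 + iota (c * w) * lam).
  rewrite [sigma _]rmorphD [sigma (_ * _)]rmorphM rmorph1 sigma_iota.
  have -> : (1 + iota (c * w) * lam) * (1 + iota (c * w) * sigma lam) =
    1 + iota (c * w) * (lam + sigma lam) + iota (c * w) ^+ 2 * (lam * sigma lam) by ring.
  have -> : 1 + c = 1 + c * w + (c * w) ^+ 2 * nu.
    have -> : 1 + c * w + (c * w) ^+ 2 * nu = 1 + c * (w + c * nu * w ^+ 2) by ring.
    by rewrite wE mulr1.
  by rewrite trl -nuE; ring.
exists (1 + iota (c * w) * lam) => //; rewrite -(norm_eq0 _ _ E).
by have [] := val_add1 _ _ dvF c (vgeW _ _ _ _ _ _ hc).
Qed.

(** * The conductor of [omega] *)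

Section NormResidueCharacter.

Variables (C : fieldType) (omega : F -> C).
Hypothesis homega : is_character omega.
Hypothesis omega_norm : forall (y : K) (a : F), y != 0 -> a%:A = y * sigma y -> omega a = 1.
Hypothesis finF : finite_residue_field vF.

Lemma omega_iota_norm y a : y != 0 -> iota a = y * sigma y -> omega a = 1.
Proof. exact: omega_norm. Qed.

(* [N (1 + w Pi^i) = 1 + w^2 N(Pi)^i + w Tr(Pi^i)] and, for [i < t], the trace term
   lies in [P_F^(i+1)]; so norms fill [U_F^i / U_F^(i+1)]. *)
Lemma omega_trivial_pred (i : nat) : (0 < i < t)%N ->
  trivial_on_U vF omega i.+1 -> trivial_on_U vF omega i.
Proof.
case/andP; case: i => [//|i] _ it triv x; rewrite /in_U => hx.
pose n := i.+1; have [N NE] := normP Pi; have vN := val_norm _ _ Pi0 NE; rewrite vPi in vN.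
have N0 : N != 0 by rewrite (norm_eq0 _ _ NE).
have Nn0 : N ^+ n != 0 by rewrite expf_neq0.
have vNn : vF (N ^+ n) = n%:Z by rewrite valX // vN; lia.
have [|w w0 hw] := residue_sqr _ _ dvF ((x - 1) / N ^+ n) finF vF2.
  have -> : 0 = n%:Z + (- n%:Z) by lia.
  by apply: vgeM => //; right; rewrite valV // vNn.
have [T TE] := traceP (Pi ^+ n).
have vT : vge vF T n.+1%:Z.
  (* Since [n < t], the value is at least [n + t >= 2 (n + 1) - 1], which rounds up to [n + 1] in
     [F]. *)
  apply: vge_iota_inv; rewrite TE; apply: (vgeW _ _ _ (n%:Z + t%:Z)); first by rewrite /n; lia.
  by apply: vge_trace; right; rewrite valX // vPi; lia.
pose y := 1 + iota w * Pi ^+ n; pose a := 1 + w * T + w ^+ 2 * N ^+ n.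
have aE : iota a = y * sigma y.
  rewrite /y [sigma _]rmorphD [sigma (_ * _)]rmorphM rmorph1 sigma_iota rmorphXn.
  have -> : iota a = 1 + iota w * iota T + iota w ^+ 2 * iota N ^+ n.
    by rewrite -!rmorphXn -!rmorphM -(rmorph1 iota) -!rmorphD.
  by rewrite TE NE exprMn rmorphXn; ring.
have va : vge vF (a - x) n.+1%:Z.
  have -> : a - x = T * w - N ^+ n * ((x - 1) / N ^+ n - w ^+ 2).
    rewrite mulrBr [N ^+ n * (_ / _)]mulrC divfK //; rewrite /a; ring.
  apply: vgeB => //; first exact: vgeMr.
  have -> : n.+1%:Z = n%:Z + 1 by lia.
  by apply: vgeM => //; right; rewrite vNn.
have [x0 vx] : x != 0 /\ vF x = 0.
  by have [] := in_U_le _ _ dvF n 0%N x isT hx.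
have [a0 va0] : a != 0 /\ vF a = 0.
  have [] := val_addl _ _ dvF _ (a - x) x0.
    by rewrite vx; apply: vgeW va; lia.
  by rewrite addrC subrK vx.
have y0 : y != 0 by rewrite -(norm_eq0 _ _ aE).
have -> : x = a * (x / a) by rewrite mulrC divfK.
rewrite charM // ?mulf_neq0 ?invr_eq0 // (omega_iota_norm _ _ y0 aE) mul1r; apply: triv.
rewrite /in_U; have -> : x / a - 1 = - (a - x) * a^-1 by rewrite opprB mulrBl divff.
by apply: vgeMr; [|exact: vgeN|right; rewrite valV // va0].
Qed.

Lemma omega_trivial_U1 : trivial_on_U vF omega t -> trivial_on_U vF omega 1.
Proof.
move=> triv; suff h k : (k < t)%N -> trivial_on_U vF omega (t - k).
  by have := t_gt0; case: t h => // n h _; have := h n (ltnSn n); rewrite subSnn.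
elim: k => [|k IH] kt; first by rewrite subn0.
by apply: omega_trivial_pred; [lia | rewrite subnSK 1?ltnW //; apply: IH; lia].
Qed.

(** A unit is a square [w^2], the norm of [w], times an element of [U_F^1]; and [N(Pi)] is a
    uniformizer of [F]. *)
Lemma omega_trivial a : trivial_on_U vF omega t -> a != 0 -> omega a = 1.
Proof.
move=> /omega_trivial_U1 triv a0.
have unit u : u != 0 -> vF u = 0 -> omega u = 1.
  move=> u0 vu; have [|w w0 hw] := residue_sqr _ _ dvF u finF vF2; first by right; rewrite vu.
  have [] := val_addl _ _ dvF u (- (u - w ^+ 2)) u0.
    by rewrite vu; exact: vgeN.
  have -> : u - (u - w ^+ 2) = w ^+ 2 by ring.
  rewrite vu => w20 vw; have -> : u = w ^+ 2 * (u / w ^+ 2) by rewrite mulrC divfK.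
  rewrite expf_eq0 /= in w20.
  rewrite charM // ?mulf_neq0 ?invr_eq0 ?expf_neq0 //.
  rewrite (omega_iota_norm (iota w)) ?mul1r ?fmorph_eq0 //; last first.
    by rewrite sigma_iota -rmorphM.
  apply: triv; rewrite /in_U.
  have -> : u / w ^+ 2 - 1 = (u - w ^+ 2) * (w ^+ 2)^-1 by rewrite mulrBl divff ?expf_neq0.
  by apply: vgeMr => //; right; rewrite valV ?expf_neq0 // vw.
have [N NE] := normP Pi; have vN := val_norm _ _ Pi0 NE; rewrite vPi in vN.
have N0 : N != 0 by rewrite (norm_eq0 _ _ NE).
have NX n : omega (N ^+ n) = 1 by apply: charX1 => //; exact: omega_iota_norm NE.
have NX0 n : N ^+ n != 0 by rewrite expf_neq0.
have NXV0 n : (N ^+ n)^-1 != 0 by rewrite invr_eq0.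
have vNX n : vF (N ^+ n) = n%:Z by rewrite valX // vN; lia.
have [k_ge0|k_lt0] := lerP 0 (vF a).
  have -> : a = a / N ^+ `|vF a| * N ^+ `|vF a| by rewrite divfK.
  rewrite charM ?mulf_neq0 // NX mulr1; apply: unit; rewrite ?mulf_neq0 //.
  by rewrite valM // valV // vNX; lia.
have <- : omega (a * N ^+ `|vF a|) = omega a by rewrite charM // NX mulr1.
by apply: unit; rewrite ?mulf_neq0 // valM // vNX; lia.
Qed.

Hypothesis omega_neq1 : exists a, a != 0 /\ omega a != 1.
Hypothesis complF : v_complete vF.

Lemma omega_trivial_U_succ : trivial_on_U vF omega t.+1.
Proof.
move=> x /= /(norm_U_succ _ complF) [y y0]; rewrite addrC subrK.
exact: omega_iota_norm.
Qed.

Lemma omega_nontrivial_U : ~ trivial_on_U vF omega t.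
Proof. by move=> triv; have [a [a0]] := omega_neq1; rewrite (omega_trivial a) ?eqxx. Qed.

Lemma conductor_omega : is_conductor vF omega t.+1.
Proof.
split=> [|i triv]; first exact: omega_trivial_U_succ.
rewrite ltnNge; apply/negP => it; apply: omega_nontrivial_U.
exact: trivial_on_U_le triv.
Qed.

(** * Conductors of symplectic type characters *)

Section Symplectic.

Variable chi : K -> C.
Hypothesis hchi : is_character chi.
Hypothesis chiA : forall a : F, a != 0 -> chi a%:A = omega a.

Lemma chi_nontrivial_U (m : nat) : (m <= 2 * t)%N -> ~ trivial_on_U vK chi m.
Proof.
move=> mt /(trivial_on_U_le _ _ _ _ _ _ dvK mt) triv; apply: omega_nontrivial_U => x Ux.
have [x0 _] := in_U_le _ _ dvF t 0%N x isT Ux.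
rewrite -chiA //; apply: triv.
(* Positivity of [t] selects the congruence branch of [in_U]. *)
have := t_gt0; case: t Ux => [//|n] /= Ux _; rewrite -[x%:A]/(iota x).
have -> : iota x - 1 = iota (x - 1) by rewrite rmorphB rmorph1.
by apply: vgeW (vge_iota _ _ Ux); lia.
Qed.

(* [U_K^(2k) = U_F^k U_K^(2k+1)], because the residue fields agree. *)
Lemma chi_trivial_even (k : nat) : (t < k)%N ->
  trivial_on_U vK chi (2 * k).+1 -> trivial_on_U vK chi (2 * k).
Proof.
move=> tk triv x; have k0 : (0 < k)%N by lia.
have -> : (2 * k = (2 * k).-1.+1)%N by lia.
move=> /= hx; have [a [b xE]] := decomp (x - 1).
rewrite xE in hx; have [ha hb] := decomp_vge _ _ _ hx.
have va : vge vF a k by apply: vge_iota_inv; apply: vgeW ha; lia.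
have [a0 va0] : 1 + a != 0 /\ vF (1 + a) = 0.
  by apply: val_add1 => //; apply: vgeW va; lia.
have ia0 : iota (1 + a) != 0 by rewrite fmorph_eq0.
have via : vK (iota (1 + a)) = 0 by rewrite vK_iota // va0.
(* The odd value of [b Pi] is at least [2k], hence at least [2k + 1]. *)
have hb' : vge vK (iota b * Pi) (2 * k).+1%:Z.
  have [->|b0] := eqVneq b 0; first by rewrite rmorph0 mul0r; left.
  have ib0 : iota b * Pi != 0 by rewrite mulf_neq0 ?fmorph_eq0.
  have := vge_val _ _ _ _ ib0 hb; rewrite vK_iotaPi // => h.
  by right; rewrite vK_iotaPi //; lia.
have E : x = iota (1 + a) * (1 + iota b * Pi / iota (1 + a)).
  rewrite mulrDr mulr1 mulrCA divff // mulr1 -[x](subrK 1) xE rmorphD rmorph1; ring.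
have hz : vge vK (iota b * Pi / iota (1 + a)) (2 * k).+1%:Z.
  by apply: vgeMr => //; right; rewrite valV // via.
have [z0 _] := val_add1 _ _ dvK _ (vgeW _ _ _ _ _ (isT : 1 <= (2 * k).+1%:Z) hz).
rewrite E charM // [chi (iota _)]chiA // (_ : omega (1 + a) = 1).
  by rewrite mul1r; apply: triv => /=; rewrite addrAC subrr add0r.
apply: omega_trivial_U_succ => /=; rewrite addrAC subrr add0r; apply: vgeW va; lia.
Qed.

Lemma conductor_symplectic m : is_conductor vK chi m ->
  (odd m -> m = (2 * t).+1) /\ (~~ odd m -> (2 * t.+1 <= m)%N).
Proof.
move=> [triv mmin].
have mt : (2 * t < m)%N by rewrite ltnNge; apply/negP => /chi_nontrivial_U.
split=> [om|em]; last by lia.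
have mE : m = (2 * m./2).+1 by lia.
(* If [m./2 <= t], then [m > 2t] leaves only [2t + 1]; otherwise minimality would give
   [2k + 1 <= 2k] with [k = m./2]. *)
rewrite mE in triv; have [mle|] := leqP m./2 t; first by lia.
by move=> /chi_trivial_even /(_ triv) /mmin; lia.
Qed.

End Symplectic.

End NormResidueCharacter.

End RamifiedQuadratic.

Theorem theorem1p1 (F : fieldType) (K : fieldExtType F) (C : numClosedFieldType)
    (vF : F -> int) (vK : K -> int) (sigma : {rmorphism K -> K}) (t : nat)
    (omega : F -> C) :
  (* F : non-Archimedean local field of characteristic zero *)
  nonarch_local_field vF -> [pchar F] =i pred0 ->
  (* K/F quadratic, vK the normalized valuation of K *)
  \dim {:K} = 2%N -> discrete_valuation vK ->
  (* K/F ramified (e = 2) ... *)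
  (forall a : F, a != 0 -> vK (a%:A) = vF a *+ 2) ->
  (* ... and wildly: residue characteristic 2, i.e. 2 lies in P_F *)
  vge vF 2 1 ->
  (* sigma : the nontrivial element of Gal(K/F) *)
  (forall a : F, sigma (a%:A) = a%:A) -> (exists x : K, sigma x != x) ->
  (* t : the ramification break *)
  ramification_break vK sigma t ->
  (* omega = omega_{K/F}: the nontrivial character of F^x trivial on norms *)
  is_character omega -> (exists a : F, a != 0 /\ omega a != 1) ->
  (forall (y : K) (a : F), y != 0 -> a%:A = y * sigma y -> omega a = 1) ->
  is_conductor vF omega t.+1 /\
  (forall (chi : K -> C) (m : nat),
     is_character chi ->
     (forall a : F, a != 0 -> chi (a%:A) = omega a) ->
     is_conductor vK chi m ->
     (odd m -> m = (2 * t).+1) /\ (~~ odd m -> (2 * t.+1 <= m)%N)).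
Proof.
move=> [dvF complF finF] _ dimK dvK vKA vF2 sA sneq tP hw wneq wnorm.
have [_ _ [Pi [Pi0 vPi]]] := dvK.
split=> [|chi m hchi chiA].
  exact: (conductor_omega F K vF vK sigma t Pi).
exact: (conductor_symplectic F K vF vK sigma t Pi) hchi chiA m.
Qed.
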